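(* Let $M\subset\mathbb{R}^n$ be a smooth compact manifold (embedded in $\mathbb{R}^n$) of dimension $l$. Then $M$ satisfies the local scaling property with respect to $\kappa=\frac{l}{n}$; that is, there exist constants $c_3,c_4,r_1>0$ such that for any $0<r<r_1$, any $0<\delta<r$ and any $x\in M$, $$c_3\,\delta^{n-l}\,r^{l}\le\mathcal{H}^n(B(x,r)\cap\Delta(M,\delta))\le c_4\,\delta^{n-l}\,r^{l}.$$
   Context: $\mathcal{H}^n$ is $n$-dimensional Hausdorff measure on $\mathbb{R}^n$ (a constant multiple of Lebesgue measure on Borel sets). For $F\subset\mathbb{R}^n$ and $\delta\ge0$, $\Delta(F,\delta):=\{x\in\mathbb{R}^n:d(x,F)<\delta\}$ is the $\delta$-neighbourhood of $F$. A set $F\subset\mathbb{R}^n$ satisfies the local scaling property with respect to $\kappa$ if there exist $c_3,c_4,r_1>0$ such that $c_3\delta^{n-\kappa n}r^{\kappa n}\le\mathcal{H}^n(B(x,r)\cap\Delta(F,\delta))\le c_4\delta^{n-\kappa n}r^{\kappa n}$ for all $0<r<r_1$, $\delta<r$ and $x\in F$. *)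

(* Defs.v *)
From mathcomp Require Import all_boot all_order all_algebra.
From mathcomp Require Import all_classical all_reals all_analysis.

Set Implicit Arguments.
Unset Strict Implicit.
Unset Printing Implicit Defensive.

Import Order.TTheory GRing.Theory Num.Theory.
Import numFieldNormedType.Exports.

Local Open Scope classical_set_scope.
Local Open Scope ring_scope.

(** R^n is ['rV[R]_n].  Its library norm and [ball] are those of the sup norm,
    so the Euclidean distance is introduced here; the two induce the same
    topology, and [open], [compact] and continuity are the library's. *)
Definition eucl_dist (R : realType) (n : nat) (x y : 'rV[R]_n) : R :=
  Num.sqrt (\sum_(i < n) (x 0 i - y 0 i) ^+ 2).

Definition eucl_ball (R : realType) (n : nat) (x : 'rV[R]_n) (r : R) :
    set 'rV[R]_n :=
  [set y | eucl_dist x y < r].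

(** [ereal_inf] makes the distance to the empty set [+oo]. *)
Definition dist_to_set (R : realType) (n : nat) (x : 'rV[R]_n)
    (F : set 'rV[R]_n) : \bar R :=
  ereal_inf [set (eucl_dist x y)%:E | y in F].

Definition nbhd_of_set (R : realType) (n : nat) (F : set 'rV[R]_n) (delta : R) :
    set 'rV[R]_n :=
  [set x | (dist_to_set x F < delta%:E)%E].

(** [-oo] on the empty set. *)
Definition eucl_diam (R : realType) (n : nat) (U : set 'rV[R]_n) : \bar R :=
  ereal_sup [set (eucl_dist p.1 p.2)%:E | p in U `*` U].

(** The empty set is weighted 0 in every dimension, including [k = 0], where
    nonempty sets are weighted 1. *)
Definition diam_gauge (R : realType) (n k : nat) (U : set 'rV[R]_n) : \bar R :=
  if U == set0 then 0%E else (eucl_diam U ^+ k)%E.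

Definition hausdorff_content (R : realType) (n k : nat) (eps : R)
    (A : set 'rV[R]_n) : \bar R :=
  ereal_inf [set (\sum_(0 <= i <oo) diam_gauge k (U i))%E | U in
    [set U : nat -> set 'rV[R]_n |
      A `<=` \bigcup_i U i /\ forall i, (eucl_diam (U i) <= eps%:E)%E]].

(** The [k]-dimensional Hausdorff (outer) measure, not normalised: for [k = n]
    it is a positive constant multiple of Lebesgue measure. *)
Definition hausdorff_measure (R : realType) (n k : nat) (A : set 'rV[R]_n) :
    \bar R :=
  ereal_sup [set hausdorff_content k eps A | eps in [set eps : R | 0 < eps]].

Definition local_scaling_property (R : realType) (n : nat) (F : set 'rV[R]_n)
    (kappa : R) : Prop :=
  exists c3 c4 r1 : R,
    [/\ 0 < c3, 0 < c4, 0 < r1 &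
      forall (r delta : R) (x : 'rV[R]_n),
        0 < r < r1 -> 0 < delta < r -> F x ->
        ((c3 * delta `^ (n%:R - kappa * n%:R) * r `^ (kappa * n%:R))%:E
           <= hausdorff_measure n (eucl_ball x r `&` nbhd_of_set F delta)
           <= (c4 * delta `^ (n%:R - kappa * n%:R) * r `^ (kappa * n%:R))%:E)%E].

(** [iter_partial [:: i1; ...; ip] f] is the iterated partial derivative
    of [f] along [i1, ..., ip]. *)
Fixpoint iter_partial (R : realType) (m k : nat) (s : seq 'I_m)
    (f : 'rV[R]_m -> 'rV[R]_k) : 'rV[R]_m -> 'rV[R]_k :=
  if s is i :: s' then 'D_(delta_mx 0 i) (iter_partial s' f) else f.

(** Meaningful for open [U]: all partial derivatives, of all orders, exist and
    are continuous at the points of [U]. *)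
Definition smooth_on_open (R : realType) (m k : nat) (U : set 'rV[R]_m)
    (f : 'rV[R]_m -> 'rV[R]_k) : Prop :=
  forall (s : seq 'I_m) (x : 'rV[R]_m), U x ->
    {for x, continuous (iter_partial s f)} /\
    forall i : 'I_m, derivable (iter_partial s f) x (delta_mx 0 i).

(** On an arbitrary set, smoothness means that [f] extends smoothly to an open
    neighbourhood of each point. *)
Definition smooth_on (R : realType) (m k : nat) (A : set 'rV[R]_m)
    (f : 'rV[R]_m -> 'rV[R]_k) : Prop :=
  forall x, A x -> exists (U : set 'rV[R]_m) (g : 'rV[R]_m -> 'rV[R]_k),
    [/\ open U, U x, smooth_on_open U g & forall y, A y -> U y -> f y = g y].

(** Continuity of [f] and [g] for the subspace topologies is part of their
    smoothness, so [f] and [g] are inverse homeomorphisms. *)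
Definition diffeomorphic (R : realType) (m k : nat) (A : set 'rV[R]_m)
    (B : set 'rV[R]_k) : Prop :=
  exists (f : 'rV[R]_m -> 'rV[R]_k) (g : 'rV[R]_k -> 'rV[R]_m),
    [/\ (forall x, A x -> B (f x) /\ g (f x) = x),
        (forall y, B y -> A (g y) /\ f (g y) = y),
        smooth_on A f & smooth_on B g].

(** [M] is a smooth manifold of dimension [l] (without boundary) embedded in
    R^n, as in Milnor's "Topology from the Differentiable Viewpoint", 1:
    every point of [M] has a relatively open neighbourhood in [M] that is
    diffeomorphic to an open subset of R^l. *)
Definition smooth_manifold (R : realType) (n l : nat) (M : set 'rV[R]_n) : Prop :=
  forall p, M p -> exists (W : set 'rV[R]_n) (V : set 'rV[R]_l),
    [/\ open W, W p, open V & diffeomorphic (M `&` W) V].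

(* Main.v *)
Require Import Defs.
From mathcomp Require Import all_boot all_order all_algebra.
From mathcomp Require Import all_classical all_reals all_analysis.
From mathcomp Require Import ring lra.
Import Order.TTheory GRing.Theory Num.Theory.
Import numFieldNormedType.Exports.
Local Open Scope classical_set_scope.
Local Open Scope ring_scope.

(** By the inverse charts, [M] is uniformly bi-Lipschitz to cubes of R^l at
    small scales. Cutting such a cube of side about [r] into a grid of cells of
    side about [delta] gives about [(r / delta)^l] cells. Their images in [M]
    have diameter at most a constant times [delta], so that many cubes of side
    about [delta] cover the piece of the neighbourhood in a ball of radius [r];
    conversely the images of the grid points are separated by a multiple of
    [delta], so that many disjoint cubes fit in it. Both counts are turned into
    bounds for the Hausdorff measure without Lebesgue measure: for the lower
    bound, a countable cover of disjoint cubes is reduced to a finite one by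
    compactness, and the points of a fine grid in the cubes are counted. *)

Set Implicit Arguments.
Unset Strict Implicit.
Unset Printing Implicit Defensive.

(** * Sup norm, Euclidean distance and grids *)

Lemma row_norm_le (R : realType) (k : nat) (x : 'rV[R]_k) (e : R) :
  0 <= e -> (forall i, `|x 0 i| <= e) -> `|x| <= e.
Proof.
move=> e0 xe; rewrite [leLHS]/Num.Def.normr/= mx_normrE (bigmax_le _ e0)//=.
by move=> -[i j] _; rewrite ord1.
Qed.

Lemma coord_norm_le (R : realType) (k : nat) (x : 'rV[R]_k) i :
  `|x 0 i| <= `|x|.
Proof.
by rewrite [leRHS]/Num.Def.normr /= mx_normrE; apply/bigmax_geP; right => /=; exists (0, i).
Qed.

Lemma norm_le_eucl (R : realType) (n : nat) (x y : 'rV[R]_n) :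
  `|x - y| <= eucl_dist x y.
Proof.
apply: row_norm_le; first exact: sqrtr_ge0.
move=> i; rewrite -sqrtr_sqr ler_wsqrtr// (bigD1 i)//= !mxE lerDl.
by apply: sumr_ge0 => j _; exact: sqr_ge0.
Qed.

(** Each of the [n] squares is at most the square of the sup norm. The crude factor [n], in place of
    its square root, is enough here and keeps all later constants free of roots. *)
Lemma eucl_le_norm (R : realType) (n : nat) (x y : 'rV[R]_n) :
  eucl_dist x y <= n%:R * `|x - y|.
Proof.
rewrite -[leRHS]ger0_norm ?mulr_ge0// -sqrtr_sqr ler_wsqrtr//.
have le1 i : (x 0 i - y 0 i) ^+ 2 <= `|x - y| ^+ 2.
  rewrite -[leLHS]real_normK ?num_real// lerXn2r ?nnegrE//.
  by have := coord_norm_le (x - y) i; rewrite !mxE.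
apply: (le_trans (ler_sum _ (fun i _ => le1 i))).
rewrite sumr_const card_ord -[leLHS]mulr_natl exprMn ler_wpM2r ?sqr_ge0//.
by rewrite -natrX ler_nat; case: (n) => // m; rewrite leq_pmulr.
Qed.

(* The cell of [u] records, coordinate by coordinate, which of the [m] equal
   subintervals of [c - w, c + w] contains [u]. *)
Lemma grid_cells (R : realType) (k m : nat) (c : 'rV[R]_k) (w : R) :
  (0 < m)%N -> 0 < w ->
  exists q : 'rV[R]_k -> {ffun 'I_k -> 'I_m},
    forall u v, `|u - c| < w -> `|v - c| < w -> q u = q v ->
      `|u - v| <= 2 * w / m%:R.
Proof.
case: m => // m _ w0.
pose t (u : 'rV[R]_k) i := (u 0 i - c 0 i + w) * m.+1%:R / (2 * w).
exists (fun u => [ffun i => inord (Num.truncn (t u i))]) => u v uc vc quv.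
(* The strict inequality keeps [t z i] below [m.+1], so [inord] leaves its truncation unchanged. *)
have tP (z : 'rV[R]_k) i : `|z - c| < w -> 0 <= t z i < m.+1%:R.
  move=> zc; have := le_lt_trans (coord_norm_le (z - c) i) zc.
  rewrite !mxE ltr_norml => /andP[h1 h2].
  have p0 : 0 <= z 0 i - c 0 i + w by lra.
  rewrite /t divr_ge0 ?mulr_ge0//=; last lra.
  by rewrite ltr_pdivrMr ?mulr_gt0// mulrC ltr_pM2l ?ltr0n//; lra.
apply: row_norm_le; first by rewrite divr_ge0// mulr_ge0// ltW.
move=> i; have /andP[u0 um] := tP u i uc; have /andP[v0 vm] := tP v i vc.
have /ffunP/(_ i) := quv; rewrite !ffunE => /(congr1 val) /=.
rewrite !inordK ?truncn_lt_nat// => tuv.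
have /andP[a1 a2] := truncn_itv u0.
have /andP[b1 b2] := truncn_itv v0.
rewrite tuv in a1 a2.
have tE : u 0 i - v 0 i = (t u i - t v i) * (2 * w) / m.+1%:R.
  rewrite /t; field; rewrite (gt_eqF w0) -[1 + _]/(1 + m%:R) .
  by rewrite -natr1 in a2 *; rewrite addrC natr1 pnatr_eq0.
have wm0 : 0 <= 2 * w / m.+1%:R by rewrite divr_ge0// mulr_ge0// ltW.
rewrite !mxE tE -mulrA normrM (ger0_norm wm0) -[leRHS]mul1r ler_wpM2r//.
rewrite -natr1 in a2 b2; rewrite ler_norml; lra.
Qed.

Lemma grid_separated (R : realType) (k m : nat) (h : R)
    (s t : {ffun 'I_k -> 'I_m}) :
  0 <= h -> s != t ->
  h <= `|(\row_i ((s i)%:R * h) : 'rV[R]_k) - \row_i ((t i)%:R * h)|.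
Proof.
move=> h0 st; have [i sti] : exists i, s i != t i.
  apply/existsP; rewrite -negb_forall; apply: contra st => /forallP st.
  by apply/eqP/ffunP => i; apply/eqP.
apply: le_trans (coord_norm_le _ i).
rewrite !mxE -mulrBl normrM (ger0_norm h0) ler_peMl//.
case: (ltngtP (s i) (t i)) sti => [lt|lt|/val_inj->]; last by rewrite eqxx.
  by rewrite distrC -natrB 1?ltnW// normr_nat ler1n subn_gt0.
by rewrite -natrB 1?ltnW// normr_nat ler1n subn_gt0.
Qed.

(** Cut the cube of radius [b] into [m ^ k] cells of side less than [h]: separated points fall into
    distinct cells. With [m] the truncation of [2 * b / h] plus one, [m * h] is at most [2 * b + h],
    hence at most [4 * b]. *)
Lemma separated_card (R : realType) (k : nat) (T : finType) (A : {set T})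
    (P : T -> 'rV[R]_k) (c : 'rV[R]_k) (b h : R) :
  0 < h -> h <= 2 * b ->
  (forall s, s \in A -> `|P s - c| < b) ->
  (forall s t, s \in A -> t \in A -> s != t -> h <= `|P s - P t|) ->
  #|A|%:R * h ^+ k <= (4 * b) ^+ k.
Proof.
move=> h0 hb Ab Asep; have b0 : 0 < b by lra.
pose m := (Num.truncn (2 * b / h)).+1.
have b0' : 0 <= 2 * b / h by rewrite divr_ge0// ltW//; lra.
have /andP[m1 m2] := truncn_itv b0'.
have [q qP] := @grid_cells R k m c b isT b0.
have qinj : {in A &, injective (q \o P)}.
  move=> s t sA tA /= qst; apply/eqP/negPn/negP => st.
  have := Asep _ _ sA tA st; apply/negP; rewrite -ltNge.
  apply: (le_lt_trans (qP _ _ (Ab _ sA) (Ab _ tA) qst)).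
  by rewrite ltr_pdivrMr ?ltr0n// (mulrC h) -ltr_pdivrMr.
have : (#|A| <= m ^ k)%N.
  rewrite -(card_in_imset qinj) (leq_trans (max_card _))//.
  by rewrite card_ffun !card_ord.
rewrite -(ler_nat R) natrX => Am.
apply: (le_trans (ler_wpM2r (exprn_ge0 _ (ltW h0)) Am)).
rewrite -exprMn lerXn2r ?nnegrE ?mulr_ge0 ?(ltW h0)//; first lra.
rewrite /m -natr1 mulrDl mul1r.
have : (Num.truncn (2 * b / h))%:R * h <= 2 * b by rewrite -ler_pdivlMr.
lra.
Qed.

(** * Diameters and the upper bound for Hausdorff measure *)

Lemma eucl_diam_ub (R : realType) (n : nat) (U : set 'rV[R]_n) x y :
  U x -> U y -> ((eucl_dist x y)%:E <= eucl_diam U)%E.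
Proof. by move=> Ux Uy; apply: ereal_sup_ubound; exists (x, y). Qed.

Lemma eucl_diam_le (R : realType) (n : nat) (U : set 'rV[R]_n) (e : R) :
  (forall x y, U x -> U y -> eucl_dist x y <= e) -> (eucl_diam U <= e%:E)%E.
Proof.
by move=> Ue; apply: ge_ereal_sup => _ [[x y] [/= Ux Uy] <-]; rewrite lee_fin Ue.
Qed.

Lemma eucl_dist_ge0 (R : realType) (n : nat) (x y : 'rV[R]_n) :
  0 <= eucl_dist x y.
Proof. exact: sqrtr_ge0. Qed.

Lemma eucl_diam_ge0 (R : realType) (n : nat) (U : set 'rV[R]_n) :
  U !=set0 -> (0 <= eucl_diam U)%E.
Proof.
by move=> [x Ux]; apply: le_trans (eucl_diam_ub Ux Ux); rewrite lee_fin eucl_dist_ge0.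
Qed.

Lemma diam_gauge_ge0 (R : realType) (n k : nat) (U : set 'rV[R]_n) :
  (0 <= diam_gauge k U)%E.
Proof.
rewrite /diam_gauge; case: ifPn => // /set0P U0.
by apply: expe_ge0; exact: eucl_diam_ge0.
Qed.

Lemma diam_gauge_le (R : realType) (n k : nat) (U : set 'rV[R]_n) (e : R) :
  0 <= e -> (forall x y, U x -> U y -> eucl_dist x y <= e) ->
  (diam_gauge k U <= (e ^+ k)%:E)%E.
Proof.
move=> e0 Ue; rewrite /diam_gauge; case: ifPn => [_|/set0P U0].
  by rewrite lee_fin exprn_ge0.
have := eucl_diam_ge0 U0; have := eucl_diam_le Ue.
case: (eucl_diam U) => // d; rewrite !lee_fin => de d0.
by rewrite -EFin_expe lee_fin lerXn2r.
Qed.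

Lemma hausdorff_content_le_sum (R : realType) (n k : nat) (eps : R)
    (A : set 'rV[R]_n) (T : finType) (U : T -> set 'rV[R]_n) :
  A `<=` \bigcup_t U t -> (forall t, (eucl_diam (U t) <= eps%:E)%E) ->
  (hausdorff_content k eps A <= \sum_t diam_gauge k (U t))%E.
Proof.
move=> AU Ueps; pose s := [seq U t | t <- enum T].
(* Padding by [set0] turns the finite family into a sequence. The empty set has gauge 0 in every
   dimension and diameter [-oo], so neither the sum nor the bound on diameters changes. *)
pose V i := nth set0 s i.
have Vout i : (size s <= i)%N -> V i = set0 by exact: nth_default.
have -> : (\sum_t diam_gauge k (U t) = \sum_(0 <= i <oo) diam_gauge k (V i))%E.
  rewrite (nneseries_split 0 (size s)); last first.
    by move=> i _; exact: diam_gauge_ge0.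
  rewrite eseries0 ?adde0; last first.
    by move=> i /Vout-> _; rewrite /diam_gauge eqxx.
  by rewrite -big_enum -(big_map U xpredT (diam_gauge k)) (big_nth set0).
apply: ereal_inf_lbound; exists V => //; split.
  move=> x /AU[t _ Utx]; exists (index t (enum T)) => //.
  by rewrite /V (nth_map t) ?nth_index ?index_mem ?mem_enum.
move=> i; have [/Vout->|si] := leqP (size s) i.
  by apply: eucl_diam_le => x y [].
have /mapP[t _ ->] : V i \in s by exact: mem_nth.
exact: Ueps.
Qed.

(** For each [eps], every cube is cut into [m ^ n] cells of Euclidean diameter at most
    [n * (2 * rho / m)], with [m] large enough to bring this below [eps]. The powers of [m] cancel
    in the total, so the bound does not depend on [eps]. *)
Lemma hausdorff_le_cubes (R : realType) (n : nat) (A : set 'rV[R]_n)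
    (T : finType) (a : T -> 'rV[R]_n) (rho : R) :
  (0 < n)%N -> 0 < rho ->
  (forall y, A y -> exists t, `|y - a t| < rho) ->
  (hausdorff_measure n A <= (#|T|%:R * (2 * n%:R * rho) ^+ n)%:E)%E.
Proof.
move=> n0 rho0 Acov; have n0' : 0 < n%:R :> R by rewrite ltr0n.
apply: ge_ereal_sup => _ [eps /= eps0 <-].
pose m := (Num.truncn (2 * n%:R * rho / eps)).+1.
have m0 : 0 < m%:R :> R by rewrite ltr0n.
pose side := 2 * rho / m%:R.
have side0 : 0 <= n%:R * side by rewrite /side mulr_ge0 ?divr_ge0 ?mulr_ge0// ltW.
have side_eps : n%:R * side <= eps.
  rewrite /side mulrA ler_pdivrMr// (mulrC eps) -ler_pdivrMr//.
  have -> : n%:R * (2 * rho) / eps = 2 * n%:R * rho / eps by ring.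
  apply/ltW; have /andP[//] : (Num.truncn (2 * n%:R * rho / eps))%:R <=
    2 * n%:R * rho / eps < m%:R.
  by apply: truncn_itv; rewrite divr_ge0 ?mulr_ge0 ?(ltW eps0) ?(ltW rho0).
have /choice[q qP] : forall t, exists q : 'rV[R]_n -> {ffun 'I_n -> 'I_m},
    forall u v, `|u - a t| < rho -> `|v - a t| < rho -> q u = q v ->
    `|u - v| <= side by move=> t; exact: grid_cells.
pose U (tc : T * {ffun 'I_n -> 'I_m}) :=
  [set y | `|y - a tc.1| < rho /\ q tc.1 y = tc.2].
have Udiam tc x y : U tc x -> U tc y -> eucl_dist x y <= n%:R * side.
  move=> [xa xq] [ya yq]; apply: (le_trans (eucl_le_norm _ _)).
  by rewrite ler_wpM2l// (qP tc.1)// xq.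
apply: (le_trans (@hausdorff_content_le_sum _ _ n _ _ _ U _ _)).
- by move=> y /Acov[t ty]; exists (t, q t y).
- by move=> tc; apply: eucl_diam_le => x y Ux /(Udiam _ _ _ Ux)/le_trans; apply.
apply: (@le_trans _ _ (\sum_(tc : T * {ffun 'I_n -> 'I_m})
    ((n%:R * side) ^+ n)%:E)%E).
  by apply: lee_sum => tc _; apply: diam_gauge_le => // x y; exact: Udiam.
rewrite sumEFin sumr_const card_prod card_ffun !card_ord lee_fin.
rewrite -[leLHS]mulr_natl natrM natrX -mulrA ler_wpM2l// -exprMn.
suff -> : m%:R * (n%:R * side) = 2 * n%:R * rho by [].
by rewrite /side; field; rewrite gt_eqF.
Qed.

(** * Lower bound for Hausdorff measure by counting grid points *)

(** A comparison of volumes by counting: put [m ^ n] grid points of step [h = rho / m] into each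
    cube. By [separated_card], the covering cube of radius [b i] contains at most
    [(4 * b i / h) ^ n] of them, and the powers of [h] cancel. *)
Lemma card_mul_le_sum_of_cover (R : realType) (n N : nat) (T : finType)
    (z : T -> 'rV[R]_n) (rho : R) (a : nat -> 'rV[R]_n) (b : nat -> R) :
  0 < rho -> (forall i, 0 < b i) ->
  (forall s t, s != t -> 2 * rho <= `|z s - z t|) ->
  (forall t y, `|y - z t| <= rho ->
     exists2 i, (i < N)%N & `|y - a i| < b i) ->
  #|T|%:R * rho ^+ n <= \sum_(i < N) (4 * b i) ^+ n.
Proof.
move=> rho0 b0 zsep cov.
(* Fine enough that [h <= 2 * b i] for all [i < N], as [separated_card] requires. *)
pose m := (\max_(i < N) Num.truncn (rho / (2 * b i))).+1.
have m0 : 0 < m%:R :> R by rewrite ltr0n.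
pose h := rho / m%:R; have h0 : 0 < h by rewrite divr_gt0.
have hb (i : 'I_N) : h <= 2 * b i.
  rewrite /h ler_pdivrMr// (mulrC (2 * _)) -ler_pdivrMr ?mulr_gt0//.
  have /andP[_ /ltW/le_trans] : (Num.truncn (rho / (2 * b i)))%:R <=
    rho / (2 * b i) < (Num.truncn (rho / (2 * b i))).+1%:R.
    by apply: truncn_itv; rewrite divr_ge0 ?mulr_ge0 ?(ltW rho0) ?(ltW (b0 _)).
  by apply; rewrite ler_nat ltnS; apply: (leq_bigmax i).
(* The grid fills only the orthant of the cube where all offsets from [z] lie in [[0, rho]]. Two
   offsets then differ by at most [rho], so grid points of distinct cubes stay at distance at least
   [2 * rho - rho >= h], even if the cubes touch. *)
pose P (tc : T * {ffun 'I_n -> 'I_m}) : 'rV[R]_n :=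
  z tc.1 + \row_i ((tc.2 i)%:R * h).
have ch0 (c : {ffun 'I_n -> 'I_m}) i : 0 <= (c i)%:R * h <= rho.
  rewrite mulr_ge0 ?(ltW h0)//= /h mulrA ler_pdivrMr// mulrC ler_wpM2l ?(ltW rho0)//.
  by rewrite ler_nat ltnW.
have Pz tc : `|P tc - z tc.1| <= rho.
  rewrite /P addrAC subrr add0r; apply: row_norm_le; first exact: ltW.
  by move=> i; rewrite !mxE; have := ch0 tc.2 i; rewrite ler_norml; lra.
have hrho : h <= rho by rewrite /h ler_pdivrMr// ler_peMr ?(ltW rho0)// ler1n.
have Psep s t : s != t -> h <= `|P s - P t|.
  case: s t => [s c] [t d]; have [<-{t}|st _] := eqVneq s t.
    move=> cd; rewrite /P/= opprD addrACA subrr add0r.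
    apply: grid_separated (ltW h0) _.
    by apply: contra cd => /eqP->.
  have zz : z s - z t = (P (s, c) - P (t, d)) + \row_i ((d i)%:R * h - (c i)%:R * h).
    by apply/rowP => i; rewrite /P !mxE/=; ring.
  have : `|\row_i ((d i)%:R * h - (c i)%:R * h)| <= rho.
    apply: row_norm_le => [|i]; first exact: ltW.
    by rewrite mxE ler_norml; have := ch0 c i; have := ch0 d i; lra.
  have := zsep _ _ st; rewrite zz.
  by move=> /le_trans /(_ (ler_normD _ _)); lra.
pose A (i : nat) := [set tc : T * {ffun 'I_n -> 'I_m} | `|P tc - a i| < b i]%SET.
have AP (i : 'I_N) : #|A i|%:R * h ^+ n <= (4 * b i) ^+ n.
  apply: (@separated_card _ _ _ (A i) P (a i)) => // [s|s t _ _ st].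
    by rewrite inE.
  exact: Psep.
apply: le_trans (ler_sum _ (fun i _ => AP i)).
rewrite -mulr_suml.
have -> : rho ^+ n = m%:R ^+ n * h ^+ n.
  by rewrite -exprMn /h mulrC divfK// gt_eqF.
rewrite mulrA ler_wpM2r ?exprn_ge0 ?(ltW h0)//.
rewrite -natrX -natrM -natr_sum ler_nat.
rewrite -[X in (_ * X ^ _)%N]card_ord -[X in (_ * _ ^ X)%N]card_ord.
rewrite -card_ffun -card_prod -sum1_card.
(* Double counting: exchanging the sums, it suffices that each grid point lies in at least one
   [A i]. *)
under [leqRHS]eq_bigr do rewrite -sum1_card big_mkcond.
rewrite exchange_big; apply: leq_sum => tc _.
have [i iN ai] := cov tc.1 (P tc) (Pz tc).
by rewrite (bigD1 (Ordinal iN))//= inE ai.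
Qed.

Lemma closed_cube_compact (R : realType) (n : nat) (z : 'rV[R]_n) (rho : R) :
  0 <= rho -> compact [set y | `|y - z| <= rho].
Proof.
move=> rho0.
have -> : [set y | `|y - z| <= rho] =
    [set v : 'rV[R]_n | forall i, `[z 0 i - rho, z 0 i + rho]%classic (v ord0 i)].
  apply/seteqP; split=> y /= yz.
    move=> i; have := le_trans (coord_norm_le (y - z) i) yz.
    by rewrite !mxE ler_norml in_itv/=; lra.
  apply: row_norm_le => // i; have := yz i.
  by rewrite !mxE ler_norml in_itv/=; lra.
by apply: (@rV_compact _ _ (fun i => `[z 0 i - rho, z 0 i + rho]%classic)) => i;
  exact: segment_compact.
Qed.

Lemma compact_sub_finite_union (X : ptopologicalType) (K : set X)
    (B : nat -> set X) :
  compact K -> (forall i, open (B i)) -> K `<=` \bigcup_i B i ->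
  exists N, forall y, K y -> exists2 i, (i < N)%N & B i y.
Proof.
rewrite compact_cover => Kcov Bo KB.
have [D _ KD] := Kcov _ setT B (fun i _ => Bo i) KB.
exists (\max_(i <- finmap.enum_fset D) i).+1 => y /KD[i /= iD Biy]; exists i => //.
by rewrite ltnS; exact: leq_bigmax_seq.
Qed.

Lemma sum_halves_le (R : realType) (tau : R) (N : nat) :
  0 <= tau -> \sum_(i < N) tau / 2 ^+ i.+1 <= tau.
Proof.
move=> tau0; suff -> : \sum_(i < N) tau / 2 ^+ i.+1 = tau - tau / 2 ^+ N.
  by rewrite lerBlDr lerDl divr_ge0// exprn_ge0.
elim: N => [|N IH]; first by rewrite big_ord0 expr0 divr1 subrr.
rewrite big_ord_recr/= {}IH exprS; field.
by rewrite expf_neq0.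
Qed.

(** Covers by sets of diameter at most 1 already give the bound. Each set of such a cover is
    enclosed in an open cube of about twice its diameter as radius; compactness of the cubes to be
    covered leaves finitely many, to which the counting bound applies. Doubling the radius turns
    [4 ^ n] into [8 ^ n], and the remaining factor 2 absorbs the errors [e i]. *)
Lemma hausdorff_ge_cubes (R : realType) (n : nat) (A : set 'rV[R]_n)
    (T : finType) (z : T -> 'rV[R]_n) (rho : R) :
  (0 < n)%N -> 0 < rho ->
  (forall s t, s != t -> 2 * rho <= `|z s - z t|) ->
  (forall t y, `|y - z t| <= rho -> A y) ->
  ((#|T|%:R * rho ^+ n / (2 * 8 ^+ n))%:E <= hausdorff_measure n A)%E.
Proof.
move=> n0 rho0 zsep zA.
apply: (@le_trans _ _ (hausdorff_content n 1 A)); last first.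
  by apply: ereal_sup_ubound; exists 1 => //=.
apply: le_ereal_inf_tmp => _ [U /= [AU Udiam] <-].
have Vge0 : 0 <= #|T|%:R * rho ^+ n by rewrite mulr_ge0 ?exprn_ge0 ?(ltW rho0).
have [T0|Tn0] := eqVneq #|T| 0%N.
  by rewrite T0 !mul0r; apply: nneseries_ge0 => i _ _; exact: diam_gauge_ge0.
have Vgt0 : 0 < #|T|%:R * rho ^+ n by rewrite mulr_gt0 ?exprn_gt0// ltr0n lt0n.
have /choice[ad adP] : forall i, exists ad : 'rV[R]_n * R,
    [/\ 0 <= ad.2, (forall y, U i y -> `|y - ad.1| <= ad.2) &
      diam_gauge n (U i) = (ad.2 ^+ n)%:E].
  move=> i; rewrite /diam_gauge; case: ifPn => [/eqP->|/set0P Ui0].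
    (* Radius 0 suits the empty set because [0 ^+ n = 0] for [n > 0]. *)
    by exists (0, 0); split=> //=; rewrite expr0n gtn_eqF.
  have [x Ux] := Ui0; have := eucl_diam_ge0 Ui0; have := Udiam i.
  case Ud : (eucl_diam (U i)) => [d| |]//= _ d0.
  exists (x, d); split=> // [y Uy|]; last by rewrite EFin_expe.
  apply: (le_trans (norm_le_eucl _ _)).
  by rewrite -lee_fin -Ud; exact: eucl_diam_ub.
pose a i := (ad i).1; pose d i := (ad i).2.
(* The total error [4 ^ n * tau] is at most half of the quantity to be bounded; [tau <= 1] gives
   [e i <= 1], hence [e i ^+ n <= e i]. *)
pose tau := Num.min 1 (#|T|%:R * rho ^+ n / (2 * 4 ^+ n)).
have tau0 : 0 < tau by rewrite lt_min ltr01 divr_gt0// mulr_gt0// exprn_gt0.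
have tau1 : tau <= 1 by rewrite ge_min lexx.
have tauV : 4 ^+ n * tau <= #|T|%:R * rho ^+ n / 2.
  have : tau <= #|T|%:R * rho ^+ n / (2 * 4 ^+ n) by rewrite ge_min lexx orbT.
  rewrite ler_pdivlMr ?mulr_gt0 ?exprn_gt0//; lra.
pose e i := tau / 2 ^+ i.+1.
have e0 i : 0 < e i by rewrite divr_gt0// exprn_gt0.
have e1 i : e i <= 1.
  rewrite /e ler_pdivrMr ?exprn_gt0// mul1r (le_trans tau1)//.
  by rewrite exprn_ege1// ler1n.
(* Open cubes need a radius strictly above [d i]: doubling provides it when [d i > 0], and [e i]
   when [d i = 0]. *)
pose b i := Num.max (2 * d i) (e i).
have b0 i : 0 < b i by rewrite lt_max e0 orbT.
have db i : d i < b i.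
  have [d0 _ _] := adP i; rewrite lt_max.
  have [->|dn0] := eqVneq (d i) 0; first by rewrite e0 orbT.
  by rewrite ltr_pMl ?ltr1n// lt_def dn0.
have bn i : b i ^+ n <= (2 * d i) ^+ n + e i.
  have [d0 _ _] := adP i; have d0' : 0 <= 2 * d i by rewrite mulr_ge0.
  rewrite /b; case: (leP (2 * d i) (e i)) => _; last by rewrite lerDl ltW.
  rewrite -[leLHS]add0r lerD ?exprn_ge0//.
  by rewrite -[leRHS]expr1 ler_wiXn2l// ltW.
have /choice[Nf NfP] : forall t, exists N, forall y, `|y - z t| <= rho ->
    exists2 i, (i < N)%N & `|y - a i| < b i.
  move=> t; have [|||N NP] := @compact_sub_finite_union 'rV[R]_n
    [set y | `|y - z t| <= rho] (fun i => ball (a i) (b i)).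
  - exact/closed_cube_compact/ltW.
  - by move=> i; exact: ball_open.
  - move=> y yt; have [i _ Uiy] := AU _ (zA _ _ yt); exists i => //.
    rewrite -ball_normE /ball_/= distrC; have [_ yai _] := adP i.
    exact: le_lt_trans (yai _ Uiy) (db i).
  exists N => y /NP[i iN]; rewrite -ball_normE /ball_/= distrC; by exists i.
pose N := \max_t Nf t.
have key : #|T|%:R * rho ^+ n <= \sum_(i < N) (4 * b i) ^+ n.
  apply: (card_mul_le_sum_of_cover (a := a) rho0 b0 zsep) => t y /NfP[i iN yi].
  by exists i => //; apply: (leq_trans iN); exact: (leq_bigmax t).
have : \sum_(i < N) (4 * b i) ^+ n <=
    8 ^+ n * (\sum_(i < N) d i ^+ n) + 4 ^+ n * \sum_(i < N) e i.
  rewrite !mulr_sumr -big_split/=; apply: ler_sum => i _.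
  rewrite (_ : 8 = 4 * 2 :> R); last by rewrite -natrM.
  rewrite exprMn [(4 * 2) ^+ n]exprMn -mulrA -[2 ^+ n * _]exprMn -mulrDr.
  by rewrite ler_wpM2l ?exprn_ge0.
have : 4 ^+ n * (\sum_(i < N) e i) <= 4 ^+ n * tau.
  by rewrite ler_wpM2l ?exprn_ge0// sum_halves_le// ltW.
(* With [V] the left side of [key] and [S] the sum of the [d i ^+ n], the estimates give
   [V <= 8 ^ n * S + V / 2]. The partial sum [S] is below the full series since its terms are
   nonnegative. *)
move=> h1 h2; apply: (@le_trans _ _ (\sum_(0 <= i < N) diam_gauge n (U i))%E).
  rewrite big_mkord; under eq_bigr => i _ do [have [_ _ ->] := adP i].
  rewrite sumEFin lee_fin ler_pdivrMr ?mulr_gt0 ?exprn_gt0//.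
  rewrite -/(d _); lra.
by apply: nneseries_lim_ge => i _ _; exact: diam_gauge_ge0.
Qed.

(** * Smooth maps are locally Lipschitz *)

Lemma derive_along_line (R : realType) (V : normedModType R) (f : V -> R)
    (x v : V) (s : R) :
  derivable f (x + s *: v) v ->
  is_derive s 1 (fun u => f (x + u *: v)) ('D_v f (x + s *: v)).
Proof.
move=> fv.
have E : (fun h => h^-1 *: (f (x + (h *: 1 + s) *: v) - f (x + s *: v))) =
    (fun h => h^-1 *: (f (h *: v + (x + s *: v)) - f (x + s *: v))).
  apply/funext => h; congr (_ *: (f _ - _)).
  by rewrite scalerDl [h *: 1]mulr1 addrCA.
by split; rewrite /derivable /derive /= E.
Qed.

(** The mean value theorem is applied to each coordinate of [f] separately. The intermediate point
    depends on the coordinate, which is harmless in the sup norm. *)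
Lemma partial_mean_value (R : realType) (m k : nat) (f : 'rV[R]_m -> 'rV[R]_k)
    (x v : 'rV[R]_m) (t K : R) :
  (forall s, 0 <= s <= t ->
     derivable f (x + s *: v) v /\ `|'D_v f (x + s *: v)| <= K) ->
  0 <= t -> `|f (x + t *: v) - f x| <= K * t.
Proof.
move=> fK t0.
have K0 : 0 <= K.
  by have [|_] := fK 0; [rewrite lexx | apply: le_trans; exact: normr_ge0].
apply: row_norm_le => [|j]; first by rewrite mulr_ge0.
pose phi u := f (x + u *: v) 0 j.
have phiD s : 0 <= s <= t -> is_derive s 1 phi ('D_v f (x + s *: v) 0 j).
  move=> /fK[fv _].
  have -> : 'D_v f (x + s *: v) 0 j = 'D_v (fun y => f y 0 j) (x + s *: v).
    by rewrite derive_mx// mxE.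
  by apply: (@derive_along_line R _ (fun y => f y 0 j)); move/derivable_mxP: fv; apply.
have [|||c] := @MVT_segment R phi (fun s => 'D_v f (x + s *: v) 0 j) 0 t => //.
- by move=> s; rewrite in_itv/= => /andP[/ltW ? /ltW ?]; apply: phiD; apply/andP.
- by apply: derivable_within_continuous => s; rewrite in_itv/= => /phiD[].
rewrite in_itv/= subr0 => ct; rewrite /phi scale0r addr0 => E.
rewrite !mxE -[X in `|X|]/(f (x + t *: v) 0 j - f x 0 j) E normrM (ger0_norm t0).
rewrite ler_wpM2r// (le_trans (coord_norm_le _ _))//.
by have [] := fK c ct.
Qed.

Lemma partial_lipschitz (R : realType) (m k : nat) (f : 'rV[R]_m -> 'rV[R]_k)
    (p x v : 'rV[R]_m) (t K e : R) :
  (forall y, `|y - p| < e -> derivable f y v /\ `|'D_v f y| <= K) ->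
  `|x - p| < e -> `|x + t *: v - p| < e ->
  `|f (x + t *: v) - f x| <= K * `|t|.
Proof.
wlog t0 : x t / 0 <= t.
  move=> H fK; have [t0|t0] := leP 0 t; first exact: H.
  move=> xp yp; rewrite distrC -(normrN t).
  have {1}-> : x = x + t *: v + - t *: v by rewrite scaleNr addrK.
  by apply: H => //; rewrite ?scaleNr ?addrK// oppr_ge0 ltW.
move=> fK xp yp; rewrite (ger0_norm t0).
apply: partial_mean_value => // s /andP[s0 st]; apply: fK.
have [t00|tn0] := eqVneq t 0.
  have -> : s = 0 by lra.
  by rewrite scale0r addr0.
have tgt0 : 0 < t by rewrite lt_def tn0.
(* The intermediate point is the convex combination of the endpoints with weight [c], so it stays in
   the cube. *)
pose c := s / t; have c01 : 0 <= c <= 1.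
  by rewrite /c divr_ge0//= ler_pdivrMr// mul1r.
have -> : x + s *: v - p = (1 - c) *: (x - p) + c *: (x + t *: v - p).
  rewrite [x + t *: v - p]addrAC (scalerDr c (x - p)) addrA -scalerDl subrK scale1r scalerA.
  by rewrite /c divfK// addrAC.
have /andP[c0 c1] := c01.
apply: (le_lt_trans (ler_normD _ _)); rewrite 2!normrZ.
rewrite (ger0_norm c0) (ger0_norm (_ : 0 <= 1 - c)) ?subr_ge0//.
have [->|cn0] := eqVneq c 0; first by lra.
have cgt0 : 0 < c by rewrite lt_def cn0.
have : c * `|x + t *: v - p| < c * e by rewrite ltr_pM2l.
have : (1 - c) * `|x - p| <= (1 - c) * e by rewrite ler_wpM2l ?subr_ge0// ltW.
lra.
Qed.

(* [y] is reached from [x] by changing one coordinate at a time, without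
   leaving the cube. *)
Lemma lipschitz_of_partials (R : realType) (m k : nat)
    (f : 'rV[R]_m -> 'rV[R]_k) (p : 'rV[R]_m) (K e : R) :
  (forall y i, `|y - p| < e ->
     derivable f y (delta_mx 0 i) /\ `|'D_(delta_mx 0 i) f y| <= K) ->
  0 <= K ->
  forall x y, `|x - p| < e -> `|y - p| < e -> `|f x - f y| <= m%:R * K * `|x - y|.
Proof.
move=> fK K0 x y xp yp.
have e0 : 0 < e by apply: le_lt_trans xp.
pose w (q : nat) : 'rV[R]_m := \row_i (if (i < q)%N then y 0 i else x 0 i).
have wp q : `|w q - p| < e.
  apply: (@le_lt_trans _ _ (Num.max `|x - p| `|y - p|)); last by rewrite gt_max xp.
  apply: row_norm_le => [|i]; first by rewrite le_max normr_ge0.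
  have := coord_norm_le (x - p) i; have := coord_norm_le (y - p) i.
  by rewrite !mxE le_max => h1 h2; case: ifPn => _; rewrite ?h1 ?h2 ?orbT.
have step q : (q <= m)%N -> `|f (w q) - f x| <= q%:R * (K * `|x - y|).
  elim: q => [_|q IH qm].
    suff -> : w 0 = x by rewrite subrr normr0 mul0r.
    by apply/rowP => i; rewrite mxE.
  pose i := Ordinal qm.
  have wS : w q.+1 = w q + (y 0 i - x 0 i) *: delta_mx 0 i.
    apply/rowP => j; rewrite !mxE eqxx/= ltnS leq_eqVlt.
    have [->|ji] := eqVneq j i; first by rewrite eqxx/= ltnn mulr1 addrC subrK.
    have -> : (j == q :> nat) = false by apply/negbTE; apply: contra ji => /eqP jq; apply/eqP/val_inj.
    by rewrite mulr0 addr0.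
  have -> : f (w q.+1) - f x = (f (w q.+1) - f (w q)) + (f (w q) - f x).
    by rewrite addrA subrK.
  apply: (le_trans (ler_normD _ _)).
  rewrite -natr1 mulrDl mul1r addrC lerD ?IH 1?ltnW//.
  rewrite wS; apply: (@le_trans _ _ (K * `|y 0 i - x 0 i|)).
    by apply: (@partial_lipschitz _ _ _ _ p _ _ _ _ e) => //; [move=> z /fK | rewrite -wS].
  rewrite ler_wpM2l// distrC.
  by have := coord_norm_le (x - y) i; rewrite !mxE.
have := step m (leqnn m).
have -> : w m = y by apply/rowP => i; rewrite mxE ltn_ord.
by rewrite distrC mulrA.
Qed.

Lemma smooth_locally_lipschitz (R : realType) (m k : nat) (U : set 'rV[R]_m)
    (f : 'rV[R]_m -> 'rV[R]_k) (p : 'rV[R]_m) :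
  open U -> U p -> smooth_on_open U f ->
  exists e K : R, [/\ 0 < e, 0 < K, forall x, `|x - p| < e -> U x &
    forall x y, `|x - p| < e -> `|y - p| < e -> `|f x - f y| <= K * `|x - y|].
Proof.
move=> Uo Up fU.
(* The sum bounds every first partial derivative at [p]; the margin 1 lets continuity extend the
   bound to a neighbourhood. *)
pose K := \sum_i `|'D_(delta_mx 0 i) f p| + 1.
have K0 : 0 < K by rewrite ltr_wpDl// sumr_ge0.
have : \forall y \near p, U y /\ forall i, `|'D_(delta_mx 0 i) f y| <= K.
  have pU : \forall y \near p, U y by exact: open_nbhs_nbhs.
  suff pK : \forall y \near p, forall i, `|'D_(delta_mx 0 i) f y| <= K.
    by apply: filterS2 pU pK => y.
  apply: (@filter_forall _ _ (fun i y => `|'D_(delta_mx 0 i) f y| <= K) _ (nbhs_filter p)) => i.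
  have [fc _] := fU [:: i] p Up.
  move/cvgrPdist_lt : fc => /(_ _ ltr01); apply: filterS => y /=.
  have : `|'D_(delta_mx 0 i) f p| <= \sum_i `|'D_(delta_mx 0 i) f p|.
    by rewrite (bigD1 i)//= lerDl sumr_ge0.
  move=> h1 h2.
  have := ler_normB ('D_(delta_mx 0 i) f p) ('D_(delta_mx 0 i) f p - 'D_(delta_mx 0 i) f y).
  by rewrite subKr /K; lra.
(* The added 1 keeps the Lipschitz constant positive also when [m = 0]. *)
move=> /nbhs_ballP[e /= e0 pe]; exists e, (m%:R * K + 1).
have pe' y : `|y - p| < e -> U y /\ forall i, `|'D_(delta_mx 0 i) f y| <= K.
  by move=> yp; apply: pe; rewrite -ball_normE /ball_/= distrC.
split=> // [||x y xp yp]; first by rewrite ltr_wpDl// mulr_ge0// ltW.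
  by move=> x /pe'[].
apply: (@le_trans _ _ (m%:R * K * `|x - y|)); last first.
  by rewrite ler_wpM2r// lerDl.
apply: (lipschitz_of_partials _ (ltW K0) xp yp) => z i zp.
have [Uz zK] := pe' z zp; split; last exact: zK.
by have [_] := fU [::] z Uz.
Qed.

(** * Uniform bi-Lipschitz charts *)

(* The constant [K] is at once the Lipschitz constant of both maps and the
   inverse radius of the cubes on which they are inverse to each other. *)
Definition bilipschitz_chart (R : realType) (n l : nat) (M : set 'rV[R]_n)
    (K : R) (x : 'rV[R]_n) : Prop :=
  exists (f : 'rV[R]_n -> 'rV[R]_l) (g : 'rV[R]_l -> 'rV[R]_n),
    (forall u v, `|u - f x| < K^-1 -> `|v - f x| < K^-1 ->
       [/\ M (g u), f (g u) = u & `|g u - g v| <= K * `|u - v|]) /\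
    (forall y z, M y -> M z -> `|y - x| < K^-1 -> `|z - x| < K^-1 ->
       g (f y) = y /\ `|f y - f z| <= K * `|y - z|).

Lemma open_cube (R : realType) (m : nat) (U : set 'rV[R]_m) (p : 'rV[R]_m) :
  open U -> U p -> exists2 e : R, 0 < e & forall y, `|y - p| < e -> U y.
Proof.
move=> Uo Up; have /nbhs_ballP[e /= e0 pe] := open_nbhs_nbhs (conj Uo Up).
by exists e => // y yp; apply: pe; rewrite -ball_normE /ball_/= distrC.
Qed.

(** A single diffeomorphism around [p] serves every nearby base point [x] and every large [K];
    compactness can make this form uniform. The Lipschitz bounds come from the local smooth
    extensions [f1] and [g1], on cubes where these agree with [f] and [g] at the points of the
    domains. *)
Lemma manifold_chart_near (R : realType) (n l : nat) (M : set 'rV[R]_n) p :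
  smooth_manifold l M -> M p ->
  exists s K0 : R, 0 < s /\ forall x K, M x -> `|x - p| < s -> K0 < K ->
    bilipschitz_chart l M K x.
Proof.
move=> Mman Mp.
have [W [V [Wo Wp Vo [f [g [MV VM fsm gsm]]]]]] := Mman p Mp.
have [Vfp _] := MV p (conj Mp Wp).
have [U1 [f1 [U1o U1p f1sm ff1]]] := fsm p (conj Mp Wp).
have [U2 [g1 [U2o U2p g1sm gg1]]] := gsm (f p) Vfp.
have [e1 [L1 [e10 L10 eU1 f1L]]] := smooth_locally_lipschitz U1o U1p f1sm.
have [e2 [L2 [e20 L20 eU2 g1L]]] := smooth_locally_lipschitz U2o U2p g1sm.
have [eW eW0 WP] := open_cube Wo Wp.
have [eV eV0 VP] := open_cube Vo Vfp.
pose e := Num.min e1 eW; have e0 : 0 < e by rewrite lt_min e10.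
pose e' := Num.min e2 eV; have e'0 : 0 < e' by rewrite lt_min e20.
have fP y : M y -> `|y - p| < e -> f y = f1 y /\ g (f y) = y.
  move=> My; rewrite lt_min => /andP[y1 yW].
  have MWy : (M `&` W) y by split=> //; exact: WP.
  by split; [apply: ff1 => //; exact: eU1 | have [] := MV y MWy].
have fL y z : M y -> M z -> `|y - p| < e -> `|z - p| < e ->
    `|f y - f z| <= L1 * `|y - z|.
  move=> My Mz ye ze; have [-> _] := fP y My ye; have [-> _] := fP z Mz ze.
  by move: ye ze; rewrite !lt_min => /andP[ye _] /andP[ze _]; exact: f1L.
have gP u : `|u - f p| < e' -> [/\ M (g u), f (g u) = u & g u = g1 u].
  rewrite lt_min => /andP[u2 uV]; have Vu := VP u uV.
  by have [[Mgu _] fgu] := VM u Vu; split=> //; apply: gg1 => //; exact: eU2.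
have gL u v : `|u - f p| < e' -> `|v - f p| < e' ->
    `|g u - g v| <= L2 * `|u - v|.
  move=> ue ve; have [_ _ ->] := gP u ue; have [_ _ ->] := gP v ve.
  by move: ue ve; rewrite !lt_min => /andP[ue _] /andP[ve _]; exact: g1L.
(* The choice of [s] puts [x] within [e / 2] of [p] and, by [fL], [f x] within [e' / 2] of [f p];
   [K0] makes [K^-1] smaller than both halves. The cubes of radius [K^-1] about [x] and [f x] then
   lie in the good cubes about [p] and [f p]. *)
pose s := Num.min (e / 2) (e' / (2 * L1)).
pose K0 := Num.max (Num.max L1 L2) (Num.max (2 / e) (2 / e')).
exists s, K0; split; first by rewrite lt_min !divr_gt0// mulr_gt0.
move=> x K Mx; rewrite lt_min => /andP[xe xe'].
rewrite !gt_max => /andP[/andP[LK1 LK2] /andP[eK eK']].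
have Kgt0 : 0 < K by apply: lt_trans LK1.
have Ke : K^-1 < e / 2.
  by rewrite -[ltRHS]invf_div ltf_pV2 ?posrE ?divr_gt0.
have Ke' : K^-1 < e' / 2.
  by rewrite -[ltRHS]invf_div ltf_pV2 ?posrE ?divr_gt0.
have fxp : `|f x - f p| < e' / 2.
  have xp : `|x - p| < e by lra.
  have pp : `|p - p| < e by rewrite subrr normr0.
  apply: (le_lt_trans (fL x p Mx Mp xp pp)).
  by rewrite -ltr_pdivlMl// (_ : L1^-1 * (e' / 2) = e' / (2 * L1))// invfM; ring.
have near_f u : `|u - f x| < K^-1 -> `|u - f p| < e'.
  move=> ux; have := ler_normD (u - f x) (f x - f p).
  by rewrite addrA subrK; lra.
have near_p y : `|y - x| < K^-1 -> `|y - p| < e.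
  move=> yx; have := ler_normD (y - x) (x - p).
  by rewrite addrA subrK; lra.
exists f, g; split=> [u v /near_f ue /near_f ve|y z My Mz /near_p ye /near_p ze].
  have [Mgu fgu _] := gP u ue; split=> //; apply: (le_trans (gL u v ue ve)).
  by rewrite ler_wpM2r// ltW.
have [_ gfy] := fP y My ye; split=> //; apply: (le_trans (fL y z My Mz ye ze)).
by rewrite ler_wpM2r// ltW.
Qed.

(** Near each point all sufficiently large [K] work. The covering form of compactness, applied to
    the filter of neighbourhoods of plus infinity, turns these local thresholds into one for all of
    [M]. *)
Lemma manifold_uniform_charts (R : realType) (n l : nat) (M : set 'rV[R]_n) :
  compact M -> smooth_manifold l M ->
  exists2 K : R, 1 <= K & forall x, M x -> bilipschitz_chart l M K x.
Proof.
move=> Mcompact Mman.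
have Mnear : near_covering_within M.
  by apply/near_covering_withinP; apply/compact_near_coveringP.
have [|K1 [_ K1P]] := Mnear R (pinfty_nbhs R)
    (fun K x => bilipschitz_chart l M K x) _.
  move=> p Mp; have [s [K0 [s0 sP]]] := manifold_chart_near Mman Mp.
  exists (ball p s, [set K | K0 < K]) => /=.
    split; first exact: nbhsx_ballx.
    by exists K0; rewrite num_real.
  move=> [x K] /= [+ K0K] Mx; rewrite -ball_normE /ball_/= distrC => xp.
  exact: sP.
exists (Num.max K1 0 + 1); first by rewrite lerDr le_max lexx orbT.
by move=> x; apply: K1P; rewrite ltr_pwDr// le_max lexx.
Qed.

(** * Both measure bounds inside one chart *)

Lemma eucl_distC (R : realType) (n : nat) (x y : 'rV[R]_n) :
  eucl_dist x y = eucl_dist y x.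
Proof.
by congr Num.sqrt; apply: eq_bigr => i _; rewrite -sqrrN opprB.
Qed.

Lemma nbhd_of_setP (R : realType) (n : nat) (F : set 'rV[R]_n) (delta : R) y :
  nbhd_of_set F delta y <-> exists2 z, F z & eucl_dist y z < delta.
Proof.
rewrite /nbhd_of_set /dist_to_set /=; split.
  by move=> /ereal_inf_lt[_ [z Fz <-]]; rewrite lte_fin; exists z.
move=> [z Fz yz]; apply: (@le_lt_trans _ _ (eucl_dist y z)%:E).
  by apply: ereal_inf_lbound; exists z.
by rewrite lte_fin.
Qed.

(** A point of the neighbourhood is within [delta] of some [z] in [M], and [z] is within [2 * r] of
    [x], so [f z] lies in the cube of radius [2 * K * r] about [f x]. The smallness of [r] keeps
    that cube inside the chart. One point of [M] per grid cell then serves as the centre of a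
    covering cube. *)
Lemma chart_hausdorff_le (R : realType) (n l : nat) (M : set 'rV[R]_n) (K : R)
    (x : 'rV[R]_n) (r delta : R) :
  (0 < n)%N -> 1 <= K -> M x -> bilipschitz_chart l M K x ->
  0 < r -> 2 * K ^+ 2 * r < 1 -> 0 < delta -> delta < r ->
  (hausdorff_measure n (eucl_ball x r `&` nbhd_of_set M delta) <=
   (2 ^+ l * (2 * n%:R * (1 + 4 * K ^+ 2)) ^+ n *
      (delta ^+ n * (r / delta) ^+ l))%:E)%E.
Proof.
move=> n0 K1 Mx [f [g [gP fP]]] r0 Kr delta0 dr.
have K0 : 0 < K by lra.
have KV : K * K^-1 = 1 by rewrite mulfV// gt_eqF.
have rK : 2 * K * r < K^-1.
  by rewrite -(ltr_pM2l K0) KV; rewrite expr2 in Kr; lra.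
have r2K : 2 * r < K^-1.
  by apply: le_lt_trans rK; rewrite ler_pM2r//; lra.
have rd0 : 0 <= r / delta by rewrite divr_ge0// ltW.
have /andP[m1 m2] := truncn_itv rd0.
(* Since [m] exceeds [r / delta], cells have side at most [4 * K * delta]; since [delta < r], [m] is
   at most [2 * (r / delta)]. *)
pose m := (Num.truncn (r / delta)).+1; rewrite -/m in m2.
have m0 : 0 < m%:R :> R by rewrite ltr0n.
have w0 : 0 < 2 * K * r by rewrite !mulr_gt0.
have [q qP] := @grid_cells R l m (f x) (2 * K * r) isT w0.
pose rep t z := [/\ M z, `|z - x| < 2 * r & q (f z) = t].
(* A cell without a representative gets the arbitrary centre 0; its cube only adds to the count. *)
have /choice[a aP] : forall t, exists z, (exists z', rep t z') -> rep t z.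
  move=> t; have [[z zt]|nz] := pselect (exists z', rep t z'); first by exists z.
  by exists 0 => /nz.
(* [delta] for the step from [y] to [z], and [K * (4 * K * delta)] for the step from [z] to the
   representative of its cell. *)
pose rho := (1 + 4 * K ^+ 2) * delta.
have c0 : 0 < 1 + 4 * K ^+ 2.
  by have := sqr_ge0 K; lra.
have rho0 : 0 < rho by rewrite mulr_gt0.
have fx z : M z -> `|z - x| < 2 * r -> `|f z - f x| < 2 * K * r.
  move=> Mz zx; have zx' : `|z - x| < K^-1 by lra.
  have xx : `|x - x| < K^-1 by rewrite subrr normr0 invr_gt0.
  have [_ /le_lt_trans] := fP z x Mz Mx zx' xx; apply.
  by rewrite -mulrA mulrCA ltr_pM2l.
apply: (le_trans (hausdorff_le_cubes (a := a) n0 rho0 _)).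
  move=> y [yx /nbhd_of_setP[z Mz yz]].
  have yz' := le_lt_trans (norm_le_eucl y z) yz.
  have yx' : `|x - y| < r by exact: le_lt_trans (norm_le_eucl x y) yx.
  have zx : `|z - x| < 2 * r.
    rewrite distrC; have := ler_normD (x - y) (y - z).
    by rewrite addrA subrK; lra.
  exists (q (f z)); have [|Ma ax qa] := aP (q (f z)); first by exists z.
  set b := a _ in Ma ax qa *.
  have cell : `|f z - f b| <= 4 * K * delta.
    apply: (le_trans (qP _ _ (fx z Mz zx) (fx b Ma ax) _)); first by rewrite qa.
    rewrite ler_pdivrMr// -mulrA -[leRHS]mulrA.
    have : r <= delta * m%:R by rewrite mulrC -ler_pdivrMr// ltW.
    by rewrite -(ler_pM2l K0); lra.
  have xx : `|x - x| < K^-1 by rewrite subrr normr0 invr_gt0.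
  have fzK : `|f z - f x| < K^-1 by exact: lt_trans (fx z Mz zx) rK.
  have fbK : `|f b - f x| < K^-1 by exact: lt_trans (fx b Ma ax) rK.
  have [_ _] := gP _ _ fzK fbK.
  have [-> _] := fP z x Mz Mx (lt_trans zx r2K) xx.
  have [-> _] := fP b x Ma Mx (lt_trans ax r2K) xx.
  move=> zb; have := ler_normD (y - z) (z - b); rewrite addrA subrK => yb.
  have : `|z - b| <= 4 * K ^+ 2 * delta.
    apply: (le_trans zb); apply: (@le_trans _ _ (K * (4 * K * delta))).
      by rewrite ler_pM2l.
    by rewrite expr2; lra.
  by rewrite /rho; lra.
rewrite card_ffun !card_ord lee_fin natrX /rho mulrA exprMn.
rewrite (_ : _ * _ * (_ * _) = (2 * (r / delta)) ^+ l *
  ((2 * n%:R * (1 + 4 * K ^+ 2)) ^+ n * delta ^+ n)); last first.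
  by rewrite [(2 * (r / delta)) ^+ l]exprMn; ring.
rewrite ler_wpM2r//.
  by rewrite mulr_ge0// exprn_ge0 ?mulr_ge0 ?(ltW c0) ?(ltW delta0).
have rd1 : 1 <= r / delta by rewrite ler_pdivlMr// mul1r ltW.
have md : m%:R <= 2 * (r / delta) by rewrite /m -natr1; lra.
by rewrite lerXn2r ?nnegrE// mulr_ge0.
Qed.

(** Grid points around [f x] are carried into [M] by [g]. As [f] is [K]-Lipschitz, their images are
    separated by the grid step divided by [K], so cubes about them fit the hypotheses of
    [hausdorff_ge_cubes]. *)
Lemma chart_hausdorff_ge (R : realType) (n l : nat) (M : set 'rV[R]_n) (K : R)
    (x : 'rV[R]_n) (r delta : R) :
  (0 < n)%N -> 1 <= K -> M x -> bilipschitz_chart l M K x ->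
  0 < r -> 2 * K ^+ 2 * r < 1 -> 0 < delta -> delta < r ->
  (((K ^- 2) ^+ l * (4 * n%:R) ^- n / (2 * 8 ^+ n) *
      (delta ^+ n * (r / delta) ^+ l))%:E <=
   hausdorff_measure n (eucl_ball x r `&` nbhd_of_set M delta))%E.
Proof.
move=> n0 K1 Mx [f [g [gP fP]]] r0 Kr delta0 dr.
have K0 : 0 < K by lra.
have d4 : delta / 4 < delta by lra.
have N1 : 1 <= n%:R :> R by rewrite ler1n.
have N0 : 0 < n%:R :> R by rewrite ltr0n.
have KV : K * K^-1 = 1 by rewrite mulfV// gt_eqF.
have rK : r < K^-1.
  rewrite -(ltr_pM2l K0) KV; apply: le_lt_trans Kr; rewrite ler_pM2r//.
  rewrite expr2 mulrCA -[leLHS]mulr1 ler_pM2l//; lra.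
(* With [rho = delta / (4 * n)] below, [n * (K * w + rho)] equals [r / 2 + delta / 4], less than
   [r]: the factor [n] pays for passing from the sup norm to the Euclidean distance. *)
pose w := r / (2 * n%:R * K).
have NK0 : 0 < 2 * n%:R * K by rewrite !mulr_gt0.
have w0 : 0 < w by rewrite divr_gt0.
have NKw : 2 * n%:R * K * w = r by rewrite /w mulrC divfK// gt_eqF.
pose rho := delta / (4 * n%:R); have rho0 : 0 < rho by rewrite divr_gt0// mulr_gt0.
have Nrho : 4 * n%:R * rho = delta.
  by rewrite /rho mulrC divfK// gt_eqF// mulr_gt0.
have Nwr : n%:R * (K * w + rho) < r by lra.
(* Step [sigma] in the chart gives separation [sigma / K = 2 * rho] in [M], and [w / sigma] is
   exactly [K ^- 2 * (r / delta)]. *)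
pose sigma := 2 * K * rho; have sigma0 : 0 < sigma.
  by apply: mulr_gt0 => //; exact: mulr_gt0.
have ws0 : 0 <= w / sigma by rewrite divr_ge0// ltW.
have /andP[m1 m2] := truncn_itv ws0.
(* Indices stop at [m - 1], the truncation of [w / sigma], so the grid stays within [w] of [f x],
   while the number [m] of values per coordinate exceeds [w / sigma]. *)
pose m := (Num.truncn (w / sigma)).+1; rewrite -/m in m2.
pose u (t : {ffun 'I_l -> 'I_m}) : 'rV[R]_l := f x + \row_i ((t i)%:R * sigma).
have uw t : `|u t - f x| <= w.
  rewrite /u addrAC subrr add0r; apply: row_norm_le => [|i]; first exact: ltW.
  have ts0 : 0 <= (t i)%:R * sigma by apply: mulr_ge0 => //; exact: ltW.
  rewrite mxE (ger0_norm ts0) -ler_pdivlMr//.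
  by apply: le_trans m1; rewrite ler_nat -ltnS.
have wr : K * w <= r / 2.
  have : 0 < K * w by rewrite mulr_gt0.
  by move: NKw N1; rewrite -!mulrA; nra.
have wK : w < K^-1.
  by apply: le_lt_trans rK; nra.
have uK t : `|u t - f x| < K^-1 by exact: le_lt_trans (uw t) wK.
have xx : `|x - x| < K^-1 by rewrite subrr normr0 invr_gt0.
have ff : `|f x - f x| < K^-1 by rewrite subrr normr0 invr_gt0.
have gfx : g (f x) = x by have [] := fP x x Mx Mx xx xx.
have zx t : `|g (u t) - x| <= K * w.
  have [_ _] := gP _ _ (uK t) ff; rewrite gfx => /le_trans; apply.
  by rewrite ler_pM2l.
have zK t : `|g (u t) - x| < K^-1 by apply: le_lt_trans (zx t) _; lra.
have Mz t : M (g (u t)) by have [] := gP _ _ (uK t) ff.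
have fz t : f (g (u t)) = u t by have [] := gP _ _ (uK t) ff.
have zsep s t : s != t -> 2 * rho <= `|g (u s) - g (u t)|.
  move=> st.
  have [_] := fP _ _ (Mz s) (Mz t) (zK s) (zK t); rewrite !fz => h.
  rewrite -(ler_pM2l K0); apply: le_trans h.
  rewrite mulrCA mulrA -/sigma /u opprD addrACA subrr add0r.
  exact: grid_separated (ltW sigma0) st.
apply: le_trans (hausdorff_ge_cubes (z := fun t => g (u t)) n0 rho0 zsep _).
  rewrite lee_fin card_ffun !card_ord natrX.
  rewrite (_ : _ * _ = (K ^- 2 * (r / delta)) ^+ l *
    ((4 * n%:R) ^- n * delta ^+ n / (2 * 8 ^+ n))); last first.
    by rewrite [(K ^- 2 * (r / delta)) ^+ l]exprMn; ring.
  rewrite [rho ^+ n]expr_div_n (mulrC (delta ^+ n)) -[leRHS]mulrA ler_wpM2r//.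
    by apply: divr_ge0; apply: mulr_ge0 => //; rewrite exprn_ge0// ltW.
  have E : K ^- 2 * (r / delta) = w / sigma.
    by rewrite /w /sigma /rho; field; rewrite !gt_eqF.
  by rewrite E lerXn2r ?nnegrE// ltW.
move=> t y yz.
have yz' : eucl_dist y (g (u t)) <= delta / 4.
  apply: (le_trans (eucl_le_norm _ _)); rewrite -Nrho.
  have : n%:R * `|y - g (u t)| <= n%:R * rho by rewrite ler_pM2l.
  lra.
split; last first.
  apply/nbhd_of_setP; exists (g (u t)); first exact: Mz.
  exact: le_lt_trans yz' d4.
apply: (le_lt_trans (eucl_le_norm _ _)).
have xy : `|x - y| <= K * w + rho.
  apply: le_trans (ler_distD (g (u t)) x y) _.
  by apply: lerD; rewrite distrC.
by apply: le_lt_trans Nwr; rewrite ler_pM2l.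
Qed.

(** * Assembling the scaling bounds *)

(** The left side is what the counts produce: the volume scale of a cube of side [delta] times the
    number of cells. *)
Lemma expr_mul_ratio_powR (R : realType) (n l : nat) (delta r : R) : 0 < delta ->
  delta ^+ n * (r / delta) ^+ l = delta `^ (n%:R - l%:R) * r ^+ l.
Proof.
move=> delta0; rewrite powRB; last by apply/implyP => _; rewrite gt_eqF.
by rewrite !powR_mulrn ?ltW// expr_div_n mulrA mulrAC.
Qed.

Lemma manifold_hausdorff_bounds (R : realType) (n l : nat) (M : set 'rV[R]_n) :
  (0 < n)%N -> compact M -> smooth_manifold l M ->
  exists c3 c4 r1 : R,
    [/\ 0 < c3, 0 < c4, 0 < r1 &
      forall (r delta : R) (x : 'rV[R]_n),
        0 < r < r1 -> 0 < delta < r -> M x ->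
        ((c3 * delta `^ (n%:R - l%:R) * r ^+ l)%:E
           <= hausdorff_measure n (eucl_ball x r `&` nbhd_of_set M delta)
           <= (c4 * delta `^ (n%:R - l%:R) * r ^+ l)%:E)%E].
Proof.
move=> n0 Mcompact Mman.
have [K K1 MK] := manifold_uniform_charts Mcompact Mman.
have K0 : 0 < K by apply: lt_le_trans K1.
have N0 : 0 < n%:R :> R by rewrite ltr0n.
(* The constants of the two chart estimates; the value of [r1] restates their condition
   [2 * K ^+ 2 * r < 1]. *)
exists ((K ^- 2) ^+ l * (4 * n%:R) ^- n / (2 * 8 ^+ n)),
  (2 ^+ l * (2 * n%:R * (1 + 4 * K ^+ 2)) ^+ n), ((2 * K ^+ 2)^-1).
have K20 : 0 < K ^+ 2 by rewrite exprn_gt0.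
split.
- by rewrite divr_gt0 ?mulr_gt0 ?invr_gt0 ?exprn_gt0 ?invr_gt0 ?mulr_gt0.
- by rewrite mulr_gt0 ?exprn_gt0// !mulr_gt0// addr_gt0// mulr_gt0.
- by rewrite invr_gt0 mulr_gt0.
move=> r delta x /andP[r0 rr1] /andP[delta0 dr] Mx.
have Kr : 2 * K ^+ 2 * r < 1 by rewrite mulrC -ltr_pdivlMr ?div1r// mulr_gt0.
have E c : c * delta `^ (n%:R - l%:R) * r ^+ l =
    c * (delta ^+ n * (r / delta) ^+ l) by rewrite expr_mul_ratio_powR// mulrA.
rewrite !E.
have xK := MK x Mx; apply/andP; split.
  exact: (chart_hausdorff_ge n0 K1 Mx xK).
exact: (chart_hausdorff_le n0 K1 Mx xK).
Qed.

Unset Implicit Arguments.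

Theorem mainTheorem3 (R : realType) (n l : nat) (M : set 'rV[R]_n)
    (hn : (0 < n)%N) (Mcompact : compact M) (Mmanifold : smooth_manifold l M) :
  local_scaling_property M (l%:R / n%:R) /\
  exists c3 c4 r1 : R,
    [/\ 0 < c3, 0 < c4, 0 < r1 &
      forall (r delta : R) (x : 'rV[R]_n),
        0 < r < r1 -> 0 < delta < r -> M x ->
        ((c3 * delta `^ (n%:R - l%:R) * r ^+ l)%:E
           <= hausdorff_measure n (eucl_ball x r `&` nbhd_of_set M delta)
           <= (c4 * delta `^ (n%:R - l%:R) * r ^+ l)%:E)%E].
Proof.
have scal := manifold_hausdorff_bounds hn Mcompact Mmanifold.
split=> //; have [c3 [c4 [r1 [c30 c40 r10 H]]]] := scal.
exists c3, c4, r1; split=> // r delta x r01 d0r Mx.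
have -> : l%:R / n%:R * n%:R = l%:R :> R.
  by rewrite divfK// pnatr_eq0 -lt0n.
rewrite powR_mulrn; last by case/andP: r01 => /ltW.
exact: H.
Qed.
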